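(* Let $T$ be a topological space, $d\ge1$, let $\mathbb{E}$ be a linear space of functions $f:T\to\mathbb{R}^d$, and let $P$ be the distribution of a random function $\xi$ with values in $\mathbb{E}$. For statements about the time-share depth $\operatorname{td}_m^{(j)}$, let $T$ be equipped with a probability measure $\mu$. For any integers $m\ge1$ and $j\ge dm+1$ the following hold. 1. (Affine invariance.) For all $f,g\in\mathbb{E}$ and all $A:T\to\mathbb{R}^{d\times d}$ with $A(t)$ nonsingular for every $t\in T$, $$\operatorname{bd}_m^{(j)}(Af+g;P_{A,g})=\operatorname{bd}_m^{(j)}(f;P)\quad\text{and}\quad \operatorname{td}_m^{(j)}(Af+g;P_{A,g})=\operatorname{td}_m^{(j)}(f;P),$$ where $(Af)(t)=A(t)f(t)$ and $P_{A,g}$ is the distribution of $A\xi+g$. 2. (Phase invariance.) For every $f\in\mathbb{E}$ and every one-to-one transformation (bijection) $h:T\to T$ with inverse $h^{-1}$, $$\operatorname{bd}_m^{(j)}(f\circ h;P^h)=\operatorname{bd}_m^{(j)}(f;P),$$ where $P^h(F)=P(F\circ h^{-1})$ for any measurable $F\subset\mathbb{E}$, with $F\circ h^{-1}=\{u\circ h^{-1}:u\in F\}$. 3. (Vanishing at infinity.) $\operatorname{bd}_m^{(j)}(f;P)\to0$ if the supremum of $\|f\|$ over $T$ converges to infinity, and $\operatorname{td}_m^{(j)}(f;P)\to0$ if the infimum of $\|f\|$ over $T$ converges to infinity.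
   Context: For $f_1,\dots,f_j\in\mathbb{E}$ and an integer $m\ge1$, the $m$-band $\operatorname{band}_m(f_1,\dots,f_j)$ is the family of all $f\in\mathbb{E}$ such that, for all $t_1,\dots,t_m\in T$ (not necessarily distinct), the vector $(f(t_1),\dots,f(t_m))\in(\mathbb{R}^d)^m$ belongs to the convex hull of the points $(f_i(t_1),\dots,f_i(t_m))$, $i=1,\dots,j$. The $m$-band time-share is $$\operatorname{TS}_m(f;f_1,\dots,f_j)=\Big\{(t_1,\dots,t_m)\in T^m:\ (f(t_1),\dots,f(t_m))\in\operatorname{conv}\big(\{(f_i(t_1),\dots,f_i(t_m))\}_{i=1}^j\big)\Big\}.$$ Let $\xi_1,\dots,\xi_j$ be i.i.d. random functions with common distribution $P$. The $m$-band depth is $$\operatorname{bd}_m^{(j)}(f;P)=\mathbf{P}\{f\in\operatorname{band}_m(\xi_1,\dots,\xi_j)\},$$ and, with $\mu^{(m)}$ the $m$-fold product measure of $\mu$ on $T^m$, the time-share depth is $$\operatorname{td}_m^{(j)}(f;P)=\mathbf{E}\,\mu^{(m)}\big(\operatorname{TS}_m(f;\xi_1,\dots,\xi_j)\big).$$ The transformed functions $Au$ and $u\circ h$, $u\in\mathbb{E}$, are understood to remain in $\mathbb{E}$, and all events and sets appearing in these definitions are understood to be measurable.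
   Formalization: The claim that band depth tends to 0 as the supremum of ‖f‖ tends to infinity is stated under the added assumption that the supremum of ‖ξ‖ over T is almost surely finite; without it the claim fails (T = ℕ, ξ = ±t with equal probability, f_n(t) = t for t ≤ n and 0 otherwise). *)

(* Defs.v *)
From HB Require Import structures.
From mathcomp Require Import all_boot all_order all_algebra.
From mathcomp Require Import all_classical all_reals all_analysis.
From mathcomp Require Import measurable_realfun.

Set Implicit Arguments.
Unset Strict Implicit.
Unset Printing Implicit Defensive.

Import Order.TTheory GRing.Theory Num.Theory.
Import numFieldTopology.Exports numFieldNormedType.Exports.

Local Open Scope classical_set_scope.
Local Open Scope ring_scope.

Section product_power.
Context d (T : measurableType d) (R : realType) (P : probability T R).

Definition tuple_cons n (p : T * n.-tuple T) : n.+1.-tuple T :=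
  [the n.+1.-tuple T of p.1 :: p.2].

Lemma measurable_tuple_cons n : measurable_fun setT (@tuple_cons n).
Proof. exact: measurable_cons. Qed.

HB.instance Definition _ n := isMeasurableFun.Build _ _ _ _
  (@tuple_cons n) (@measurable_tuple_cons n).

(* The n-fold product measure of P, i.e. the joint law of n independent
   P-distributed elements; [prob_powerE] is its defining property. *)
Fixpoint prob_power n : probability (n.-tuple T) R :=
  if n is n'.+1 then distribution (P \x prob_power n')%E (@tuple_cons n')
  else \d_([tuple] : 0.-tuple T).

Lemma prob_powerE n (A : 'I_n -> set T) : (forall i, measurable (A i)) ->
  prob_power n [set t | forall i, A i (tnth t i)] = (\prod_(i < n) P (A i))%E.
Proof.
elim: n A => [|n IHn] A mA.
  by rewrite big_ord0 /= diracE mem_set// => -[].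
rewrite big_ord_recl -IHn//= /distribution /pushforward /=.
rewrite -product_measure1E //; last first.
  rewrite [X in measurable X](_ : _ = \bigcap_(i in [set: 'I_n])
      ((@tnth n T)^~ i @^-1` A (lift ord0 i))); last first.
    by apply/seteqP; split => [t tA i _|t tA i]; [exact: tA|exact: (tA i I)].
  apply: fin_bigcap_measurable => // i _.
  by rewrite -[X in measurable X]setTI; exact: measurable_tnth.
congr product_measure1; apply/seteqP; split => [[x t] /= h|[x t] /= [Ax At] i].
  split; first by have := h ord0.
  by move=> i; have := h (lift ord0 i); rewrite tnthS.
by case: (unliftP ord0 i) => [k|] ->//; rewrite tnthS.
Qed.

End product_power.

(* A copy of [X] pointed at [x0]: measurable types have to be pointed. *)
Definition pointed_at (X : Type) (x0 : X) : Type := X.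

HB.instance Definition _ (X : Type) (x0 : X) := gen_eqMixin (pointed_at x0).
HB.instance Definition _ (X : Type) (x0 : X) := gen_choiceMixin (pointed_at x0).
HB.instance Definition _ (X : Type) (x0 : X) :=
  isPointed.Build (pointed_at x0) x0.

Section function_space.
Context (R : realType) (T : Type) (d : nat).

(* Linear spaces of functions are linear subspaces of [T -> 'cV[R]_d]; this is
   the type of the elements of such a subspace. It is pointed so that
   [g_sigma_algebraType] can equip it with an arbitrary sigma-algebra. *)
Definition fspace (E : submodClosed (T -> 'cV[R]_d)) : Type :=
  {f : T -> 'cV[R]_d | f \in E}.

Context (E : submodClosed (T -> 'cV[R]_d)).

HB.instance Definition _ := gen_eqMixin (fspace E).
HB.instance Definition _ := gen_choiceMixin (fspace E).
HB.instance Definition _ :=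
  isPointed.Build (fspace E) (exist _ 0 (rpred0 E)).

Definition fval (u : fspace E) : T -> 'cV[R]_d := sval u.

End function_space.

Section convex_hull.
Context (R : realType) (V : lmodType R).

Definition conv (X : set V) : set V :=
  [set v | exists n (w : 'I_n -> R) (x : 'I_n -> V),
    [/\ forall k, 0 <= w k, \sum_k w k = 1, forall k, X (x k)
      & v = \sum_k w k *: x k]].

End convex_hull.

Section norms.
Context (R : realType) (T : Type) (d : nat).

Definition enorm (x : 'cV[R]_d) : R := Num.sqrt (\sum_i x i 0 ^+ 2).

Definition sup_norm (f : T -> 'cV[R]_d) : \bar R :=
  ereal_sup [set (enorm (f t))%:E | t in [set: T]].

Definition inf_norm (f : T -> 'cV[R]_d) : \bar R :=
  ereal_inf [set (enorm (f t))%:E | t in [set: T]].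

End norms.

Section depths.
Context (R : realType) (T : Type) (d : nat) (E : submodClosed (T -> 'cV[R]_d)).
Implicit Types (m j : nat) (f : T -> 'cV[R]_d).

Definition eval_at m (t : m.-tuple T) f : {ffun 'I_m -> 'cV[R]_d} :=
  [ffun k => f (tnth t k)].

Definition band m j (u : j.-tuple (fspace E)) : set (T -> 'cV[R]_d) :=
  [set f | f \in E /\ forall t : m.-tuple T,
     conv [set eval_at t (fval (tnth u i)) | i in [set: 'I_j]] (eval_at t f)].

Definition time_share m j f (u : j.-tuple (fspace E)) : set (m.-tuple T) :=
  [set t | conv [set eval_at t (fval (tnth u i)) | i in [set: 'I_j]]
             (eval_at t f)].

Context (S : set (set (fspace E))) (P : probability (g_sigma_algebraType S) R).

(* The i.i.d. functions with distribution [P] are the coordinates of a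
   [j]-tuple under the product measure. *)
Definition band_depth m j f : \bar R :=
  prob_power P j [set u : j.-tuple (g_sigma_algebraType S) | band m u f].

Context (t0 : T) (ST : set (set (pointed_at t0)))
  (mu : probability (g_sigma_algebraType ST) R).

Definition time_share_depth m j f : \bar R :=
  (\int[prob_power P j]_u prob_power mu m (@time_share m j f u))%E.

End depths.

Definition band_measurable (R : realType) (T : Type) (d : nat)
    (E : submodClosed (T -> 'cV[R]_d)) (S : set (set (fspace E)))
    (m j : nat) : Prop :=
  forall f, f \in E ->
    measurable [set u : j.-tuple (g_sigma_algebraType S) | band m u f].

Definition time_share_measurable (R : realType) (T : Type) (d : nat)
    (E : submodClosed (T -> 'cV[R]_d)) (S : set (set (fspace E)))
    (t0 : T) (ST : set (set (pointed_at t0)))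
    (mu : probability (g_sigma_algebraType ST) R) (m j : nat) : Prop :=
  forall f, f \in E ->
    (forall u : j.-tuple (g_sigma_algebraType S),
       measurable (time_share f u : set (m.-tuple (g_sigma_algebraType ST)))) /\
    measurable_fun [set: j.-tuple (g_sigma_algebraType S)]
      (fun u => prob_power mu m (time_share f u) : \bar R).

(* Main.v *)
Require Import Defs.
From HB Require Import structures.
From mathcomp Require Import all_boot all_order all_algebra.
From mathcomp Require Import all_classical all_reals all_analysis.
From mathcomp Require Import measurable_realfun ring.

Set Implicit Arguments.
Unset Strict Implicit.
Unset Printing Implicit Defensive.

Import Order.TTheory GRing.Theory Num.Theory.
Import numFieldTopology.Exports numFieldNormedType.Exports.

Local Open Scope classical_set_scope.
Local Open Scope ring_scope.

(* The law of i.i.d. copies of phi(xi) is the image of the law of i.i.d. copies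
   of xi, so both invariances reduce to identities between events: pointwise
   invertible affine maps commute with convex combinations, and a bijection of T
   permutes the m-tuples of points.
   For the limits, a filter converging to infinite norm can be replaced by a
   sequence f_n of norm > n. If f_n lies in the hull of u_1, ..., u_j at a point,
   its norm there is at most the sum of those of the u_i; so almost every sample
   is eventually outside the bands (every point eventually outside the time
   shares), and dominated convergence applies to the indicators. Passing to
   sequences avoids the distribution function of sup_norm xi, which need not be
   measurable. *)

(** * Sequences in place of filters *)

Lemma cvg_cvgy_seq (R : realType) (X : topologicalType) (l : X) (I : Type)
    (F : set_system I) (FF : Filter F) (a : I -> \bar R) (g : I -> X) :
  a i @[i --> F] --> +oo%E ->
  (forall s : nat -> I, (forall n, (n%:R%:E < a (s n))%E) ->
     g (s n) @[n --> \oo] --> l) ->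
  g i @[i --> F] --> l.
Proof.
move=> ay gs U lU; apply: contrapT => nFU.
(* Otherwise the [F]-large set where [a i > n] would lie in the preimage of [U], which is not in
   [F]. Choosing one such index per [n] gives a sequence that never enters [U]. *)
have far n : exists i, (n%:R%:E < a i)%E /\ ~ U (g i).
  apply: contrapT => /forallNP H; apply: nFU.
  apply: filterS (cvgey_gt ay n%:R) => i ai.
  by apply: contrapT => nU; apply: (H i).
have [s sP] := choice far.
have [N _ NU] := gs s (fun n => (sP n).1) U lU.
by apply: (sP N).2; apply: NU => /=.
Qed.

(** * Laws of i.i.d. tuples and their images *)

Section probability_tuples.
Context d d' (T : measurableType d) (T' : measurableType d') (R : realType).
Implicit Types (P : probability T R) (phi : T -> T').

Lemma measurable_map_tuple phi n : measurable_fun setT phi ->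
  measurable_fun setT (map_tuple phi : n.-tuple T -> n.-tuple T').
Proof.
move=> mphi; apply/measurable_fun_tnthP => i.
rewrite (_ : _ \o _ = phi \o (@tnth n T)^~ i).
  by apply: measurableT_comp => //; exact: measurable_tnth.
by apply/funext => t /=; rewrite tnth_map.
Qed.

(** Induction on [n] through sections: a change of variables handles the first coordinate, the
    induction hypothesis the measure of each section. *)
Lemma prob_power_pushforward P (P' : probability T' R) phi :
  measurable_fun setT phi ->
  (forall A, measurable A -> P' A = P (phi @^-1` A)) ->
  forall n (A : set (n.-tuple T')), measurable A ->
  prob_power P' n A = prob_power P n (map_tuple phi @^-1` A).
Proof.
move=> mphi P'E; elim=> [|n IHn] A mA.
  rewrite /= (_ : [tuple] = map_tuple phi [tuple]) ?diracE//; exact: val_inj.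
have mB : measurable (@tuple_cons _ T' n @^-1` A).
  by rewrite -[X in measurable X]setTI; exact: measurable_tuple_cons.
(* Both steps hold by conversion: the power of order [n.+1] is the image of a binary product under
   [tuple_cons]. *)
transitivity ((P' \x prob_power P' n)%E (@tuple_cons _ T' n @^-1` A)) => //.
transitivity ((P \x prob_power P n)%E
    (@tuple_cons _ T n @^-1` (map_tuple phi @^-1` A))) => //.
rewrite /product_measure1.
rewrite (eq_measure_integral (pushforward P phi)); last first.
  by move=> D mD _; exact: P'E.
rewrite ge0_integral_pushforward//; last exact: measurable_fun_xsection.
rewrite preimage_setT; apply: eq_integral => x _ /=.
rewrite IHn; last exact: measurable_xsection.
congr (prob_power P n _); apply/seteqP; split => t /=;
  rewrite /xsection/= !inE /= (_ : map_tuple phi (tuple_cons (x, t)) =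
    tuple_cons (phi x, map_tuple phi t))//; exact: val_inj.
Qed.

End probability_tuples.

Lemma cvg_probability0 d (T : measurableType d) (R : realType)
    (Q : probability T R) (B : nat -> set T) : (forall n, measurable (B n)) ->
  {ae Q, forall x, \forall n \near \oo, ~ B n x} ->
  Q (B n) @[n --> \oo] --> 0%E.
Proof.
move=> mB nB.
have := @dominated_convergence _ T R Q setT measurableT
  (fun n x => (\1_(B n) x)%:E) (cst 0%E) (cst 1%E).
case.
- by move=> n; exact/measurable_EFinP/measurable_indic.
- exact: measurable_cst.
- apply: filterS nB => x nBx _; apply: cvg_near_cst.
  by apply: filterS nBx => n nBnx; rewrite indicE memNset.
- exact: finite_measure_integrable_cst.
- apply: aeW => x n _; rewrite indicE /= lee_fin.
  by case: (_ \in _); rewrite ?normr1 ?normr0.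
- move=> _ _; rewrite integral0 /=.
  under eq_fun do rewrite integral_indic// setIT.
  by [].
Qed.

(** The exceptional points lie in a null set [N], and the box of tuples avoiding [N] in every
    coordinate has measure a product of ones. *)
Lemma prob_power_ae d (T : measurableType d) (R : realType)
    (P : probability T R) (p : set T) n :
  {ae P, forall x, p x} ->
  {ae prob_power P n, forall t, forall i, p (tnth t i)}.
Proof.
move=> [N [mN PN0 pN]].
pose C := [set t : n.-tuple T | forall i, (~` N) (tnth t i)].
have mC : measurable C.
  rewrite (_ : C = \bigcap_(i in [set: 'I_n]) ((@tnth n T)^~ i @^-1` (~` N))).
    apply: fin_bigcap_measurable => // i _.
    rewrite -[X in measurable X]setTI.
    by apply: measurable_tnth => //; exact: measurableC.
  by apply/seteqP; split => [t tC i _|t tC i]; [exact: tC|exact: (tC i I)].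
have PC : prob_power P n C = 1%E.
  rewrite [LHS](@prob_powerE _ _ _ P n (fun=> ~` N)); last first.
    by move=> _; exact: measurableC.
  by rewrite big1// => i _; rewrite probability_setC// PN0 sube0.
exists (~` C); split; first exact: measurableC.
- by rewrite probability_setC// PC subee.
- move=> t /= + Ct; apply => i; apply: contrapT => np.
  exact/(Ct i)/pN.
Qed.

Lemma ge0_integral_prob_power_pushforward d d' (T : measurableType d)
    (T' : measurableType d') (R : realType) (P : probability T R)
    (P' : probability T' R) (phi : T -> T') n (f : n.-tuple T' -> \bar R) :
  measurable_fun setT phi ->
  (forall A, measurable A -> P' A = P (phi @^-1` A)) ->
  measurable_fun setT f -> (forall x, 0 <= f x)%E ->
  (\int[prob_power P' n]_x f x = \int[prob_power P n]_x f (map_tuple phi x))%E.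
Proof.
move=> mphi P'E mf f0.
have mphin := @measurable_map_tuple _ _ T T' phi n mphi.
rewrite (eq_measure_integral (pushforward (prob_power P n) (map_tuple phi))).
  by rewrite ge0_integral_pushforward.
by move=> D mD _; exact: prob_power_pushforward.
Qed.

(** * Convexity of the Euclidean norm *)

Section convex_combinations.
Context (R : realType) (d : nat).

(** Jensen's inequality for the square, by the tangent line at the mean. *)
Lemma sqr_convex_comb_le n (w y : 'I_n -> R) :
  (forall k, 0 <= w k) -> \sum_k w k = 1 ->
  (\sum_k w k * y k) ^+ 2 <= \sum_k w k * y k ^+ 2.
Proof.
move=> w0 w1; set a := \sum_k _.
(* The tangent to the square at [a] is [2 * a * y - a ^+ 2]; its weighted mean is [a ^+ 2], and it
   lies below [y ^+ 2] by [(y - a) ^+ 2]. *)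
have -> : a ^+ 2 = \sum_k w k * (2 * a * y k - a ^+ 2).
  under eq_bigr do rewrite mulrBr.
  rewrite sumrB -mulr_suml w1; under eq_bigr do rewrite mulrCA.
  by rewrite -mulr_sumr -/a; ring.
apply: ler_sum => k _; apply: ler_wpM2l => //.
by rewrite -subr_ge0 (_ : _ - _ = (y k - a) ^+ 2) ?sqr_ge0//; ring.
Qed.

Lemma enorm_ge0 (x : 'cV[R]_d) : 0 <= enorm x.
Proof. exact: sqrtr_ge0. Qed.

Lemma enorm_le (x : 'cV[R]_d) M : 0 <= M ->
  (enorm x <= M) = (\sum_i x i 0 ^+ 2 <= M ^+ 2).
Proof.
move=> M0; rewrite /enorm -[in LHS](ger0_norm M0) -sqrtr_sqr ler_sqrt//.
exact: sqr_ge0.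
Qed.

Lemma enorm_convex_comb_le n (w : 'I_n -> R) (x : 'I_n -> 'cV[R]_d) M :
  0 <= M -> (forall k, 0 <= w k) -> \sum_k w k = 1 ->
  (forall k, enorm (x k) <= M) -> enorm (\sum_k w k *: x k) <= M.
Proof.
move=> M0 w0 w1 xM; rewrite enorm_le//.
apply: (@le_trans _ _ (\sum_i \sum_k w k * x k i 0 ^+ 2)).
  apply: ler_sum => i _; rewrite summxE.
  under eq_bigr do rewrite mxE.
  exact: sqr_convex_comb_le.
rewrite exchange_big /= -[leRHS]mul1r -w1 mulr_suml.
by apply: ler_sum => k _; rewrite -mulr_sumr ler_wpM2l// -enorm_le.
Qed.

End convex_combinations.

(** * Convex hulls of functions evaluated at a tuple *)

Section conv_eval.
Context (R : realType) (T : Type) (d m j : nat).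
Implicit Types (t : m.-tuple T) (f g : T -> 'cV[R]_d).
Implicit Types (u : 'I_j -> T -> 'cV[R]_d).

(** Each point of the combination is traced back to an index [s k], so that the same weights and
    indices serve all coordinates and can be reused after transforming the functions. *)
Lemma conv_evalP t u f :
  Defs.conv [set eval_at t (u i) | i in [set: 'I_j]] (eval_at t f) <->
  exists n (w : 'I_n -> R) (s : 'I_n -> 'I_j),
    [/\ forall k, 0 <= w k, \sum_k w k = 1
      & forall l, f (tnth t l) = \sum_k w k *: u (s k) (tnth t l)].
Proof.
split=> [[n [w [x [w0 w1 ux fE]]]]|[n [w [s [w0 w1 fE]]]]].
  have us k : exists i, eval_at t (u i) = x k by have [i _ ?] := ux k; exists i.
  have [s sP] := choice us.
  exists n, w, s; split=> // l.
  move/ffunP/(_ l): fE; rewrite ffunE sum_ffunE => ->; apply: eq_bigr => k _.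
  by rewrite -sP /GRing.scale/= !ffunE.
exists n, w, (fun k => eval_at t (u (s k))); split=> //.
apply/ffunP => l; rewrite ffunE sum_ffunE fE; apply: eq_bigr => k _.
by rewrite [in RHS]/GRing.scale/= !ffunE.
Qed.

(** Balls are convex; the sum of the norms serves as a common radius because its terms are
    nonnegative. *)
Lemma enorm_conv_eval_le t u f l :
  Defs.conv [set eval_at t (u i) | i in [set: 'I_j]] (eval_at t f) ->
  enorm (f (tnth t l)) <= \sum_i enorm (u i (tnth t l)).
Proof.
move=> /conv_evalP[n [w [s [w0 w1 ->]]]].
apply: enorm_convex_comb_le => // [|k].
  by apply: sumr_ge0 => i _; exact: enorm_ge0.
rewrite (bigD1 (s k))//= lerDl.
by apply: sumr_ge0 => i _; exact: enorm_ge0.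
Qed.

Lemma conv_eval_comp (h : T -> T) t u f :
  Defs.conv [set eval_at t (u i \o h) | i in [set: 'I_j]] (eval_at t (f \o h)) <->
  Defs.conv [set eval_at (map_tuple h t) (u i) | i in [set: 'I_j]]
    (eval_at (map_tuple h t) f).
Proof.
have E (v : T -> 'cV[R]_d) : eval_at t (v \o h) = eval_at (map_tuple h t) v.
  by apply/ffunP => l; rewrite !ffunE tnth_map.
by rewrite E; under eq_imagel do rewrite E.
Qed.

Lemma conv_eval_affine_imply (A : T -> 'M[R]_d) g t u f :
  Defs.conv [set eval_at t (u i) | i in [set: 'I_j]] (eval_at t f) ->
  Defs.conv [set eval_at t (fun x => A x *m u i x + g x) | i in [set: 'I_j]]
    (eval_at t (fun x => A x *m f x + g x)).
Proof.
move=> /conv_evalP[n [w [s [w0 w1 fE]]]]; apply/conv_evalP.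
exists n, w, s; split=> // l; rewrite fE mulmx_sumr.
under [RHS]eq_bigr do rewrite scalerDr scalemxAr.
(* The weights sum to 1, so the translation comes out of the combination unchanged. *)
by rewrite big_split/= -scaler_suml w1 scale1r.
Qed.

Lemma conv_eval_affine (A : T -> 'M[R]_d) g t u v f :
  (forall x, A x \in unitmx) ->
  (forall i, v i = fun x => A x *m u i x + g x) ->
  Defs.conv [set eval_at t (v i) | i in [set: 'I_j]]
    (eval_at t (fun x => A x *m f x + g x)) <->
  Defs.conv [set eval_at t (u i) | i in [set: 'I_j]] (eval_at t f).
Proof.
move=> Au vE; have -> : v = fun i x => A x *m u i x + g x by exact/funext.
split; last exact: conv_eval_affine_imply.
(* The converse is the forward implication for the inverse affine map, with matrix [invmx (A x)] and
   translation [- (invmx (A x) *m g x)]. *)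
have inv f' : (fun x => invmx (A x) *m (A x *m f' x + g x)
    - invmx (A x) *m g x) = f'.
  by apply/funext => x; rewrite mulmxDr mulKmx// addrK.
move=> /(conv_eval_affine_imply (fun x => invmx (A x))
  (fun x => - (invmx (A x) *m g x))).
by rewrite inv; under eq_imagel do rewrite inv.
Qed.

End conv_eval.

Lemma fval_inj (R : realType) (T : Type) (d : nat)
  (E : submodClosed (T -> 'cV[R]_d)) : injective (@fval R T d E).
Proof. by move=> [u uE] [v vE] /= uv; apply: eq_exist. Qed.

(** * Invariance and vanishing of the depths *)

Section depth_properties.
Context (R : realType) (T : Type) (d : nat) (E : submodClosed (T -> 'cV[R]_d)).
Context (S : set (set (fspace E))) (m j : nat).
Local Notation FE := (g_sigma_algebraType S).

Lemma time_share_affine (u v : j.-tuple (fspace E)) (f g : T -> 'cV[R]_d)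
    (A : T -> 'M[R]_d) : (forall x, A x \in unitmx) ->
  (forall i, fval (tnth v i) = fun x => A x *m fval (tnth u i) x + g x) ->
  time_share (fun x => A x *m f x + g x) v = time_share f u :> set (m.-tuple T).
Proof.
move=> Au uv; apply/seteqP; split => t;
  by have [] := @conv_eval_affine _ _ _ _ _ A g t _ _ f Au uv.
Qed.

(** Lets facts about time shares, such as affine invariance, pass to bands. *)
Lemma bandE (u : j.-tuple (fspace E)) (f : T -> 'cV[R]_d) :
  band m u f = (f \in E /\ time_share f u = [set: m.-tuple T]).
Proof.
rewrite propeqE; split=> [[fE uf]|[fE uf]]; split=> //.
  by apply/seteqP; split => // t _; exact: uf.
by move=> t; rewrite -[Defs.conv _ _]/(time_share f u t) uf.
Qed.

Lemma band_depth_affine dO (Omega : measurableType dO) (Pr : probability Omega R)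
    (xi eta : {RV Pr >-> FE}) (f g : T -> 'cV[R]_d) (A : T -> 'M[R]_d) :
  band_measurable S m j -> f \in E -> (fun t => A t *m f t + g t) \in E ->
  (forall t, A t \in unitmx) ->
  (forall w, fval (eta w) = fun t => A t *m fval (xi w) t + g t) ->
  band_depth (distribution Pr eta) m j (fun t => A t *m f t + g t) =
  band_depth (distribution Pr xi) m j f.
Proof.
move=> mband fE AfgE Au etaE; rewrite /band_depth.
(* Both depths are pulled back to [j]-tuples of [Omega], where [eta] and [xi] are read at the same
   sample points and the two events coincide. *)
rewrite (@prob_power_pushforward _ _ _ _ _ Pr _ eta)//; last exact: mband.
rewrite (@prob_power_pushforward _ _ _ _ _ Pr _ xi)//; last exact: mband.
congr (prob_power Pr j _); apply/funext => w; rewrite /preimage /= !bandE.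
rewrite AfgE fE (@time_share_affine (map_tuple xi w))// => i.
by rewrite !tnth_map.
Qed.

Lemma time_share_depth_affine dO (Omega : measurableType dO)
    (Pr : probability Omega R) (xi eta : {RV Pr >-> FE}) (f g : T -> 'cV[R]_d)
    (A : T -> 'M[R]_d) (t0 : T) (ST : set (set (pointed_at t0)))
    (mu : probability (g_sigma_algebraType ST) R) :
  time_share_measurable S mu m j ->
  f \in E -> (fun t => A t *m f t + g t) \in E ->
  (forall t, A t \in unitmx) ->
  (forall w, fval (eta w) = fun t => A t *m fval (xi w) t + g t) ->
  time_share_depth (distribution Pr eta) mu m j (fun t => A t *m f t + g t) =
  time_share_depth (distribution Pr xi) mu m j f.
Proof.
move=> mTS fE AfgE Au etaE; rewrite /time_share_depth.
rewrite (@ge0_integral_prob_power_pushforward _ _ _ _ _ Pr _ eta)//;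
  last exact: (mTS _ AfgE).2.
rewrite (@ge0_integral_prob_power_pushforward _ _ _ _ _ Pr _ xi)//;
  last exact: (mTS _ fE).2.
apply: eq_integral => w _; congr (prob_power mu m _).
apply: time_share_affine => // i.
by rewrite !tnth_map.
Qed.

Lemma band_depth_phase (P Ph : probability FE R) (f : T -> 'cV[R]_d)
    (h hinv : T -> T) :
  band_measurable S m j -> f \in E -> cancel h hinv -> cancel hinv h ->
  (forall u, u \in E -> u \o h \in E) ->
  (forall F : set FE, measurable F ->
     let Fh : set FE := [set v | exists2 u, F u & fval v = fval u \o hinv] in
     measurable Fh /\ Ph F = P Fh) ->
  band_depth Ph m j (f \o h) = band_depth P m j f.
Proof.
move=> mband fE hK hinvK hE PhE.
(* Preimages under [H] are the sets [Fh], so the hypothesis on [Ph] says both that [H] is measurable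
   and that [Ph] is the image of [P] under it. *)
pose H (v : FE) : FE := exist _ (fval v \o h) (hE _ (valP v)).
have HE F : [set v : FE | exists2 u : FE, F u & fval v = fval u \o hinv] =
    H @^-1` F.
  apply/seteqP; split => v /= => [[u Fu vE]|FHv].
    rewrite (_ : H v = u)//; apply/fval_inj/funext => x.
    by rewrite -[LHS]/(fval v (h x)) vE /= hK.
  exists (H v) => //; apply/funext => x.
  by rewrite -[RHS]/(fval v (h (hinv x))) hinvK.
have mH : measurable_fun setT H by move=> _ F /PhE[]; rewrite HE setTI.
rewrite /band_depth (@prob_power_pushforward _ _ _ _ _ P _ H)//.
- congr (prob_power P j _); apply/seteqP; split => u [_ uf]; split => //=.
  (* Every tuple is the image under [h] of its image under [hinv], so testing [f \o h] on all tuples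
     tests [f] on all tuples. *)
  + move=> t; rewrite (_ : t = map_tuple h (map_tuple hinv t)).
      apply/conv_eval_comp.
      by have := uf (map_tuple hinv t); under eq_imagel do rewrite tnth_map.
    by apply: eq_from_tnth => i; rewrite !tnth_map hinvK.
  + exact: (hE f).
  + move=> t; under eq_imagel do rewrite tnth_map.
    by apply/conv_eval_comp; exact: uf.
- by move=> F mF; rewrite (PhE F mF).2 HE.
- by apply: mband; exact: (hE f).
Qed.

Lemma band_depth_vanishing dO (Omega : measurableType dO)
    (Pr : probability Omega R) (xi : {RV Pr >-> FE}) :
  (0 < m)%N -> band_measurable S m j ->
  {ae Pr, forall w, (sup_norm (fval (xi w)) < +oo)%E} ->
  forall (I : Type) (F : set_system I) (FF : Filter F) (f : I -> fspace E),
    sup_norm (fval (f i)) @[i --> F] --> +oo%E ->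
    band_depth (distribution Pr xi) m j (fval (f i)) @[i --> F] --> 0%E.
Proof.
move=> m0 mband xi_fin I F FF f fy; apply: (cvg_cvgy_seq FF fy) => s ns.
have mB n : measurable [set u : j.-tuple FE | band m u (fval (f (s n)))].
  by apply: mband; exact: valP.
rewrite /band_depth.
under eq_fun do rewrite (@prob_power_pushforward _ _ _ _ _ Pr _ xi)//.
apply: cvg_probability0 => [n|].
  by rewrite -[X in measurable X]setTI; apply: measurable_map_tuple.
apply: filterS (prob_power_ae j xi_fin) => w wfin.
have bnd i : exists M, forall x, enorm (fval (xi (tnth w i)) x) <= M.
  have ub x : ((enorm (fval (xi (tnth w i)) x))%:E <=
      sup_norm (fval (xi (tnth w i))))%E.
    by apply: ereal_sup_ubound; exists x.
  have := wfin i; case: sup_norm ub => // [r|] ub _.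
    by exists r => x; rewrite -lee_fin.
  (* The supremum is [-oo] only for empty [T], so a point [x] is contradictory here. *)
  by exists 0 => x; have := ub x; rewrite leeNy_eq.
have [M MP] := choice bnd.
(* Once [n] exceeds the sum of the uniform bounds, band membership would force the sup norm of the
   n-th function to be at most [n]. *)
apply: filterS (nbhs_infty_ger (\sum_i M i)) => n Mn [_ nf].
have := ns n; apply/negP; rewrite -leNgt.
apply: ge_ereal_sup => _ [x _ <-]; rewrite lee_fin.
(* The constant tuple at [x] reduces the band condition to the single point [x]. *)
have := enorm_conv_eval_le (Ordinal m0) (nf [tuple of nseq m x]).
rewrite tnth_nseq => /le_trans; apply; apply: le_trans Mn.
by apply: ler_sum => i _; rewrite tnth_map.
Qed.

Lemma time_share_depth_vanishing (P : probability FE R) (t0 : T)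
    (ST : set (set (pointed_at t0)))
    (mu : probability (g_sigma_algebraType ST) R) :
  (0 < m)%N -> time_share_measurable S mu m j ->
  forall (I : Type) (F : set_system I) (FF : Filter F) (f : I -> fspace E),
    inf_norm (fval (f i)) @[i --> F] --> +oo%E ->
    time_share_depth P mu m j (fval (f i)) @[i --> F] --> 0%E.
Proof.
move=> m0 mTS I F FF f fy; apply: (cvg_cvgy_seq FF fy) => s ns.
have fsE n : fval (f (s n)) \in E by exact: valP.
rewrite /time_share_depth.
have := @dominated_convergence _ _ R (prob_power P j) setT measurableT
  (fun n u => prob_power mu m (time_share (fval (f (s n))) u)) (cst 0%E) (cst 1%E).
case.
- by move=> n; exact: (mTS _ (fsE n)).2.
- exact: measurable_cst.
(* A second, inner dominated convergence, now under the power of [mu] with the sample [u] fixed. *)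
- apply: aeW => u _; apply: cvg_probability0 => [n|].
    exact: (mTS _ (fsE n)).1.
  apply: aeW => t; pose x := tnth t (Ordinal m0).
  (* The threshold may depend on [u] and [t]: only the values at the first coordinate [x] of [t]
     matter, since the infimum norm is at most the norm at [x]. *)
  apply: filterS (nbhs_infty_ger (\sum_i enorm (fval (tnth u i) x))) => n un nf.
  have := ns n; apply/negP; rewrite -leNgt.
  apply: (@le_trans _ _ (enorm (fval (f (s n)) x))%:E).
    by apply: ereal_inf_lbound; exists x.
  by rewrite lee_fin; apply: le_trans un; exact: enorm_conv_eval_le nf.
- exact: finite_measure_integrable_cst.
- apply: aeW => u n _; rewrite gee0_abs//; apply: probability_le1.
  exact: (mTS _ (fsE n)).1.
- by move=> _ _; rewrite integral0.
Qed.

End depth_properties.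

Theorem theorem1 (R : realType) (T : topologicalType) (d : nat)
    (d_ge1 : (1 <= d)%N)
    (E : submodClosed (T -> 'cV[R]_d)) (S : set (set (fspace E)))
    (dO : measure_display) (Omega : measurableType dO)
    (Pr : probability Omega R) (xi : {RV Pr >-> g_sigma_algebraType S})
    (m j : nat) (m_ge1 : (1 <= m)%N) (j_ge : (d * m + 1 <= j)%N)
    (band_meas : band_measurable S m j) :
  let P := distribution Pr xi in
  [/\ (* affine invariance *)
      forall (f g : T -> 'cV[R]_d) (A : T -> 'M[R]_d)
        (eta : {RV Pr >-> g_sigma_algebraType S}),
        f \in E -> g \in E -> (forall t, A t \in unitmx) ->
        (forall u, u \in E -> (fun t => A t *m u t) \in E) ->
        (forall w, fval (eta w) = fun t => A t *m fval (xi w) t + g t) ->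
        let PAg := distribution Pr eta in
        let Afg := fun t => A t *m f t + g t in
        band_depth PAg m j Afg = band_depth P m j f /\
        (forall (t0 : T) (ST : set (set (pointed_at t0)))
           (mu : probability (g_sigma_algebraType ST) R),
           time_share_measurable S mu m j ->
           time_share_depth PAg mu m j Afg = time_share_depth P mu m j f),
      (* phase invariance *)
      forall (f : T -> 'cV[R]_d) (h hinv : T -> T)
        (Ph : probability (g_sigma_algebraType S) R),
        f \in E -> cancel h hinv -> cancel hinv h ->
        (forall u, u \in E -> u \o h \in E) ->
        (forall F : set (g_sigma_algebraType S), measurable F ->
           let Fh : set (g_sigma_algebraType S) :=
             [set v | exists2 u, F u & fval v = fval u \o hinv] in
           measurable Fh /\ Ph F = P Fh) ->
        band_depth Ph m j (f \o h) = band_depth P m j f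
    & (* vanishing at infinity; the first claim needs bounded sample paths *)
      ({ae Pr, forall w, (sup_norm (fval (xi w)) < +oo)%E} ->
       forall (I : Type) (F : set_system I) (FF : Filter F) (f : I -> fspace E),
         sup_norm (fval (f i)) @[i --> F] --> +oo%E ->
         band_depth P m j (fval (f i)) @[i --> F] --> 0%E) /\
      (forall (t0 : T) (ST : set (set (pointed_at t0)))
         (mu : probability (g_sigma_algebraType ST) R),
         time_share_measurable S mu m j ->
         forall (I : Type) (F : set_system I) (FF : Filter F) (f : I -> fspace E),
           inf_norm (fval (f i)) @[i --> F] --> +oo%E ->
           time_share_depth P mu m j (fval (f i)) @[i --> F] --> 0%E)].
Proof.
split; [|by move=> *; exact: band_depth_phase|].
- move=> f g A eta fE gE Au AE etaE PAg Afg.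
  have AfgE : Afg \in E := rpredD (AE _ fE) gE.
  split; first exact: band_depth_affine.
  by move=> t0 ST mu mTS; exact: time_share_depth_affine.
- split; first exact: band_depth_vanishing.
  by move=> t0 ST mu; exact: time_share_depth_vanishing.
Qed.
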